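(* Let $A=\{0,1\}$, let $v(\omega,1)\ge v(\omega,0)$ for all $\omega\in\Omega$, let $\mathcal P_0,\mathcal P_1$ be closed, and assume that $\mathcal P_1^c=\{\mu\in\Delta(\Omega):\hat\rho(\mu)<0\}$ is convex. Then the convex program $$\max_{t_0,t_1}\ \sum_{\omega\in\Omega}\big(v(\omega,1)t_1(\omega)+v(\omega,0)t_0(\omega)\big)\ \text{ s.t. }\ t_a\in\mathrm{Conv}(\mathcal P_a\cup\{\mathbf 0\})\ (a=0,1),\quad t_0(\omega)+t_1(\omega)=\mu^*(\omega)\ \forall\omega\in\Omega \tag{C}$$ (which is equivalent to the sender's persuasion problem) can be optimized by solving the linear program $$\max_{t_0,t_1}\ \sum_{\omega\in\Omega}\big(v(\omega,1)t_1(\omega)+v(\omega,0)t_0(\omega)\big)\ \text{ s.t. }\ t_1\in\mathrm{Conv}(K_1\cup K_{01}\cup\{\mathbf 0\}),\quad t_0\in\mathrm{Conv}(L_0\cup\{\mathbf 0\}),\quad t_0(\omega)+t_1(\omega)=\mu^*(\omega)\ \forall\omega\in\Omega. \tag{L}$$ That is, (C) and (L) have the same optimal value, and every optimal solution of (L) is an optimal solution of (C).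
   Context: $\Omega$ is a finite nonempty set of states, $\Delta(\Omega)\subset\mathbb R^\Omega$ the simplex of probability vectors, $\mu^*\in\Delta(\Omega)$ the prior. The receiver's utility is a function $\rho:\Delta(\Omega)\times\{0,1\}\to\mathbb R$, the sender's utility is $v:\Omega\times\{0,1\}\to\mathbb R$, and $\hat\rho(\mu)=\rho(\mu,1)-\rho(\mu,0)$. Put $\mathcal P_1=\{\mu\in\Delta(\Omega):\hat\rho(\mu)\ge0\}$ and $\mathcal P_0=\{\mu\in\Delta(\Omega):\hat\rho(\mu)\le0\}$. Complements are taken in $\Delta(\Omega)$. A state $\omega$ is identified with the vertex $e_\omega\in\Delta(\Omega)$ (point mass at $\omega$), so $\Omega\subset\Delta(\Omega)$. Define $$K_1=\mathcal P_1\cap\Omega,\qquad K_0=\mathcal P_0\cap\Omega,\qquad L_0=K_0\cap K_1^c .$$ For $\omega_0\in L_0$, $\omega_1\in K_1$ let $\gamma(\omega_0,\omega_1)=\sup\{\gamma\in[0,1]:\gamma\omega_0+(1-\gamma)\omega_1\in\mathcal P_1\}$, $\chi(\omega_0,\omega_1)=\gamma(\omega_0,\omega_1)\,\omega_0+(1-\gamma(\omega_0,\omega_1))\,\omega_1$, and $K_{01}=\{\chi(\omega_0,\omega_1):\omega_0\in L_0,\ \omega_1\in K_1\}$. $\mathrm{Conv}$ denotes convex hull and $\mathbf 0\in\mathbb R^\Omega$ the zero vector. *)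

(* Defs.v *)
From HB Require Import structures.
From mathcomp Require Import all_boot all_order all_algebra.
From mathcomp Require Import all_classical all_reals all_analysis.

Set Implicit Arguments.
Unset Strict Implicit.
Unset Printing Implicit Defensive.

Import Order.TTheory GRing.Theory Num.Theory numFieldNormedType.Exports.

Local Open Scope classical_set_scope.
Local Open Scope ring_scope.

(* R^Omega. [R^o] is [R] seen as a module over itself, which makes this function
   type an [lmodType R]. *)
Notation vec R Omega := (Omega -> R^o).

Section Persuasion.
Context {R : realType} {Omega : finType}.
Implicit Types (rho : vec R Omega -> bool -> R) (v : Omega -> bool -> R).
Implicit Types (mu x : vec R Omega) (A : set (vec R Omega)).
Implicit Types (t : bool -> vec R Omega) (F : set (bool -> vec R Omega)).

Definition simplex : set (vec R Omega) :=
  [set mu | (forall w, 0 <= mu w) /\ \sum_w mu w = 1].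

Definition vertex (w : Omega) : vec R Omega := fun w' => (w' == w)%:R.

Definition convex A : Prop := @convex_set R (vec R Omega) A.

Definition Conv A : set (vec R Omega) := smallest convex A.

(* The action set {0, 1} is [bool], with 1 = [true]. The receiver's utility [rho]
   is only ever evaluated on [simplex], so its values elsewhere are irrelevant. *)
Definition rho_hat rho mu : R := rho mu true - rho mu false.

Definition P rho (a : bool) : set (vec R Omega) :=
  [set mu | simplex mu /\
            if a then 0 <= rho_hat rho mu else rho_hat rho mu <= 0].

(* States are identified with vertices, so the next sets consist of vectors. *)
Definition K rho (a : bool) : set (vec R Omega) := P rho a `&` range vertex.

Definition L0 rho : set (vec R Omega) := K rho false `\` K rho true.

(* For [x1] in [K rho true] the set is nonempty (it contains 0) and bounded, so
   the total operator [sup] is its supremum. *)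
Definition gamma rho x0 x1 : R :=
  sup [set g : R | 0 <= g <= 1 /\ P rho true (g *: x0 + (1 - g) *: x1)].

Definition chi rho x0 x1 : vec R Omega :=
  gamma rho x0 x1 *: x0 + (1 - gamma rho x0 x1) *: x1.

Definition K01 rho : set (vec R Omega) :=
  [set chi rho x0 x1 | x0 in L0 rho & x1 in K rho true].

(* The pair (t_0, t_1) is encoded as [t : bool -> vec R Omega]. *)
Definition objective v t : R :=
  \sum_w (v w true * t true w + v w false * t false w).

Definition feasibleC rho mu : set (bool -> vec R Omega) :=
  [set t | [/\ Conv (P rho false `|` [set 0]) (t false),
               Conv (P rho true `|` [set 0]) (t true) &
               forall w, t false w + t true w = mu w]].

Definition feasibleL rho mu : set (bool -> vec R Omega) :=
  [set t | [/\ Conv (L0 rho `|` [set 0]) (t false),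
               Conv (K rho true `|` K01 rho `|` [set 0]) (t true) &
               forall w, t false w + t true w = mu w]].

Definition optimal_value v F (m : R) : Prop :=
  [set objective v t | t in F] m /\ ubound [set objective v t | t in F] m.

Definition optimal_solution v F t : Prop :=
  F t /\ forall t', F t' -> objective v t' <= objective v t.

End Persuasion.

(* Main.v *)
Require Import Defs.
From mathcomp Require Import all_boot all_order all_algebra.
From mathcomp Require Import all_classical all_reals all_analysis.
From mathcomp Require Import unstable ring lra.

Set Implicit Arguments.
Unset Strict Implicit.
Unset Printing Implicit Defensive.

Import Order.TTheory GRing.Theory Num.Theory numFieldNormedType.Exports.

Local Open Scope classical_set_scope.
Local Open Scope ring_scope.

(** Every point [x] of [P rho true] lies in the hull of [K rho true], [K01 rho]
    and 0. Otherwise some linear form [F] is positive on these generators and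
    negative at [x]. Then the states with [F < 0] belong to [L0 rho], and
    whenever [F i < 0 <= F j] the point of the edge [i j] where [F] vanishes is
    outside [P rho true]: if [j] is in [K rho true] it is closer to [i] than the
    threshold point [chi], otherwise the whole edge is in the complement.
    As [x] is a nonnegative combination of such edge points and of vertices with
    [F < 0], convexity of the complement puts [x] outside [P rho true].

    In a feasible pair of (C), the mass that [t false] puts on [K rho true] can
    therefore be moved to [t true]: this yields a feasible pair of (L) and, as
    [v w false <= v w true], does not decrease the objective. All generators of
    (L) being finitely many, its feasible set is compact and the maximum is
    attained. *)

(** * Continuity in the product topology *)

Lemma continuous_ptws (T : topologicalType) (I : Type) (V : topologicalType)
    (f : T -> {ptws I -> V}) :
  (forall i, continuous (fun t => f t i)) -> continuous f.
Proof.
move=> fc t; apply/cvg_sup => i U [_ [[W oW <-] Wft] WU].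
by apply: filterS WU _; apply: (fc i t); exact: open_nbhs_nbhs.
Qed.

Lemma ptws_eval_continuous (I : finType) (V : topologicalType) (i : I) :
  continuous (fun f : {ptws I -> V} => f i).
Proof. exact: (@proj_continuous I (fun=> V) i). Qed.

Lemma continuous_big_sum (T : topologicalType) (R : realType) (I : finType)
    (f : I -> T -> R) :
  (forall i, continuous (f i)) -> continuous (fun t => \sum_i f i t).
Proof.
move=> fc; elim: (index_enum I) => [|i s IHs] t.
  under eq_fun do rewrite big_nil; exact: cvg_cst.
under eq_fun do rewrite big_cons.
apply: cvgD; [exact: fc|exact: IHs].
Qed.

Section RealValued.
Context {T : topologicalType} {R : realType}.
Implicit Types f g : T -> R.

Lemma continuous_addR f g :
  continuous f -> continuous g -> continuous (fun t => f t + g t).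
Proof. by move=> fc gc t; apply: cvgD; [exact: fc|exact: gc]. Qed.

Lemma continuous_mulR f g :
  continuous f -> continuous g -> continuous (fun t => f t * g t).
Proof. by move=> fc gc t; apply: cvgM; [exact: fc|exact: gc]. Qed.

Lemma continuous_subR f g :
  continuous f -> continuous g -> continuous (fun t => f t - g t).
Proof. by move=> fc gc t; apply: cvgB; [exact: fc|exact: gc]. Qed.
End RealValued.

(** * Convex hulls, separation and cones *)

Section Convexity.
Context {R : realType} {Omega : finType}.
Implicit Types (A B S : set (vec R Omega)) (x y z : vec R Omega).

(** Replaces the interval-typed weight of [convex_set] by two real weights with sum 1, which suit
    [lra] and [nra]. *)
Lemma convexP A :
  convex A <-> forall x y (a b : R), 0 <= a -> 0 <= b -> a + b = 1 ->
    A x -> A y -> A (a *: x + b *: y).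
Proof.
split=> [cA x y a b a0 b0 ab1 Ax Ay|cA x y l /set_mem Ax /set_mem Ay].
  have a1 : a <= 1 by rewrite -ab1 lerDl.
  have := cA x y (Itv01 a0 a1) (mem_set Ax) (mem_set Ay).
  by rewrite inE /conv/= /onem (_ : 1 - a = b)//; lra.
by apply/mem_set/cA => //; rewrite ?subr_ge0 ?le1 ?addrNK// /onem subrKC.
Qed.

Lemma convex_Conv S : convex (Conv S).
Proof.
apply/convexP => x y a b a0 b0 ab Sx Sy B [cB SB].
by move/convexP: (cB); apply => //; [apply: Sx|apply: Sy].
Qed.

Lemma Conv_le S B : S `<=` Conv B -> Conv S `<=` Conv B.
Proof. by apply: smallest_sub; exact: convex_Conv. Qed.

Lemma convexD A x y (a b : R) : convex A -> 0 <= a -> 0 <= b -> A x -> A y ->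
  exists2 z, A z & a *: x + b *: y = (a + b) *: z.
Proof.
move=> /convexP cA a0 b0 Ax Ay.
have [ab0|ab0] := eqVneq (a + b) 0.
  (* Both weights vanish, so any point of [A] serves. *)
  exists x => //; have [-> ->] : a = 0 /\ b = 0 by split; lra.
  by rewrite addr0 !scale0r addr0.
exists ((a / (a + b)) *: x + (b / (a + b)) *: y).
  by apply: cA => //; rewrite ?divr_ge0 ?addr_ge0// -mulrDl divff.
by rewrite scalerDr !scalerA !mulrA ![(a + b) * _]mulrC !mulfK.
Qed.

(** Induction on a list of the points: adding [s0] to a nonempty [T] gives the join of [s0] with
    [Conv T], the continuous image of the compact set [[0, 1] * Conv T]. A singleton is a separate
    base case, since the join with an empty hull would be empty. *)
Lemma compact_Conv (S : set (vec R Omega)) :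
  finite_set S -> compact (Conv S : set {ptws Omega -> R^o}).
Proof.
case/finite_seqP=> s ->; elim: s => [|s0 [|s1 s] IHs].
- by rewrite set_nil /Conv smallest_id//; exact: compact0.
- rewrite set_cons1 /Conv smallest_id; first exact: compact_set1.
  by apply/convexP => _ _ a b _ _ ab -> ->; rewrite -scalerDl ab scale1r.
set T := [set` s1 :: s] in IHs *.
(* A second component for the pair that represents [s0] itself, where its weight is 0. *)
have T1 : Conv T s1 by apply: sub_gen_smallest; rewrite /T /= mem_head.
pose f (p : R * {ptws Omega -> R^o}) : {ptws Omega -> R^o} :=
  p.1 *: (s0 : vec R Omega) + (1 - p.1) *: (p.2 : vec R Omega).
have cf : continuous f.
  apply: continuous_ptws => w.
  have c0 (c : R) : continuous (fun p : R * {ptws Omega -> R^o} => c).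
    exact: cst_continuous.
  have c1 : continuous (fun p : R * {ptws Omega -> R^o} => p.1 : R).
    by move=> p; exact: cvg_fst.
  have c2 : continuous (fun p : R * {ptws Omega -> R^o} => p.2 w : R).
    move=> p.
    apply: (@continuous_comp _ _ _ snd (fun g : {ptws Omega -> R^o} => g w) p).
      exact: cvg_snd.
    exact: ptws_eval_continuous.
  exact: (continuous_addR (continuous_mulR c1 (c0 (s0 w)))
           (continuous_mulR (continuous_subR (c0 1) c1) c2)).
have cX := compact_setX (@segment_compact R 0 1) IHs.
have cfX : compact (f @` (`[0, 1]%classic `*` Conv T)).
  by apply: continuous_compact cX; exact: continuous_subspaceT.
suff -> : Conv [set` [:: s0, s1 & s]] = f @` (`[0, 1]%classic `*` Conv T).
  exact: cfX.
clear cfX cX cf IHs.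
have -> : [set` [:: s0, s1 & s]] = s0 |` T.
  by apply/seteqP; split=> x /=; rewrite in_cons => /predU1P.
apply/seteqP; split.
  apply: smallest_sub.
    apply/convexP => _ _ a b a0 b0 ab1
      [[l x] [/= l01 Tx] <-] [[m y] [/= m01 Ty] <-].
    move: l01 m01; rewrite !in_itv/= => /andP[l0 l1] /andP[m0 m1].
    (* The weights of the two points of [Conv T] in the combination; [convexD] merges these points
       into one. *)
    have [al bm] : 0 <= a * (1 - l) /\ 0 <= b * (1 - m) by split; nra.
    have [z Tz zE] := convexD (@convex_Conv T) al bm Tx Ty.
    have abE : a * (1 - l) + b * (1 - m) = 1 - (a * l + b * m) by lra.
    exists (a * l + b * m, z); rewrite /f/=.
      split => //=; rewrite in_itv/=; nra.
    by rewrite -abE -zE !scalerDr !scalerA scalerDl addrACA.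
  move=> x [->|Tx].
    exists (1, s1); rewrite /f/= ?subrr ?scale0r ?scale1r ?addr0//.
    by split => //=; rewrite in_itv/= ler01 lexx.
  exists (0, x); rewrite /f/= ?subr0 ?scale0r ?scale1r ?add0r//; split => //=.
    by rewrite in_itv/= ler01 lexx.
  exact: sub_gen_smallest.
move=> _ [[l x] [/= + Tx] <-]; rewrite in_itv/= => /andP[l0 l1].
move/convexP: (@convex_Conv (s0 |` T)); apply=> //; rewrite ?subr_ge0 ?subrKC//.
  by apply: sub_gen_smallest; left.
by apply: (Conv_le _ Tx) => t Tt; apply: sub_gen_smallest; right.
Qed.

(** The normal [a] is [q - x], where [q] is the point of [A] nearest to [x]; the level [b] lies
    halfway between the values of [a] at [x] and at [q]. Minimality of [q] along segments inside [A]
    keeps the form from dropping below its value at [q]. *)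
Lemma separation A x : convex A -> compact (A : set {ptws Omega -> R^o}) ->
  A !=set0 -> ~ A x ->
  exists (a : Omega -> R) (b : R), \sum_w a w * x w < b /\
    forall y, A y -> b < \sum_w a w * y w.
Proof.
move=> /convexP cA compA A0 nAx.
pose dist (y : {ptws Omega -> R^o}) : R := \sum_w (y w - x w) * (y w - x w).
have dist_cont : continuous dist.
  apply: (@continuous_big_sum {ptws Omega -> R^o} R Omega
    (fun w y => (y w - x w) * (y w - x w))) => w.
  have cw : continuous (fun y : {ptws Omega -> R^o} => y w - x w : R).
    apply: continuous_subR; first exact: ptws_eval_continuous.
    exact: cst_continuous.
  exact: continuous_mulR.
have [q /set_mem Aq qmin] :=
  @compact_EVT_min {ptws Omega -> R^o} R _ A A0 compA
    (continuous_subspaceT dist_cont).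
pose a w : R := q w - x w.
have dE : dist q = \sum_w a w * a w by [].
have d_gt0 : 0 < dist q.
  rewrite lt_neqAle; apply/andP; split; last first.
    by apply: sumr_ge0 => w _; rewrite -expr2 sqr_ge0.
  apply/negP => /eqP/esym d0; apply: nAx; suff <- : q = x by [].
  apply/funext => w; apply/eqP; rewrite -subr_eq0 -sqrf_eq0 expr2; apply/eqP.
  apply: (psumr_eq0P _ d0) => // i _; by rewrite -expr2 sqr_ge0.
exists a, (\sum_w a w * x w + dist q / 2); split.
  by rewrite ltrDl divr_gt0.
move=> y Ay.
pose s := \sum_w a w * (y w - q w).
pose r := \sum_w (y w - q w) * (y w - q w).
have r_ge0 : 0 <= r by apply: sumr_ge0 => w _; rewrite -expr2 sqr_ge0.
(* The change of the squared distance to [x] on moving from [q] a fraction [t] of the way to [y]. *)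
have quad t : 0 <= t -> t <= 1 -> 0 <= 2 * t * s + t * t * r.
  move=> t0 t1.
  have := qmin (t *: y + (1 - t) *: q) (mem_set (cA _ _ _ _ t0 _ _ Ay Aq)).
  rewrite subr_ge0 subrKC => /(_ t1 erefl).
  suff -> : dist (t *: y + (1 - t) *: q) = dist q + (2 * t * s + t * t * r).
    by rewrite lerDl.
  rewrite dE /dist !mulr_sumr -!big_split/=; apply: eq_bigr => w _.
  have E (Y Q X : R) : (t * Y + (1 - t) * Q - X) * (t * Y + (1 - t) * Q - X) =
    (Q - X) * (Q - X) + (2 * t * ((Q - X) * (Y - Q)) +
                         t * t * ((Y - Q) * (Y - Q))) by ring.
  exact: E.
have s_ge0 : 0 <= s.
  rewrite leNgt; apply/negP => s0.
  have rs : 0 < r - s by lra.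
  (* If [s < 0], this parameter lies in [0, 1] even when [r = 0], and the quadratic is negative
     there. *)
  have := quad (- s / (r - s)).
  rewrite ler_pdivrMr// divr_ge0 ?oppr_ge0 ?(ltW s0) ?(ltW rs)// mul1r.
  rewrite -subr_ge0 opprK subrK => /(_ erefl r_ge0).
  rewrite (_ : _ + _ = s * s * (2 * s - r) / (r - s) ^+ 2); last first.
    by field; rewrite gt_eqF.
  rewrite leNgt => /negP; apply.
  rewrite pmulr_llt0 ?invr_gt0 ?exprn_gt0// pmulr_rlt0; first lra.
  by rewrite -expr2 exprn_even_gt0//= lt_eqF.
have -> : \sum_w a w * y w = \sum_w a w * x w + dist q + s.
  rewrite dE -!big_split/=; apply: eq_bigr => w _; rewrite /a.
  have E (X Y Q : R) : (Q - X) * Y =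
    (Q - X) * X + (Q - X) * (Q - X) + (Q - X) * (Y - Q) by ring.
  exact: E.
by rewrite -addrA ltrD2l; lra.
Qed.

(** The guard [0 < c] puts 0 in the cone even of an empty set; [L0 rho] or [K rho true] may be
    empty. *)
Definition cone A : set (vec R Omega) :=
  [set z | exists c d, [/\ 0 <= c, 0 < c -> A d & z = c *: d]].

Lemma cone_sub A : A `<=` cone A.
Proof. by move=> x Ax; exists 1, x; rewrite scale1r. Qed.

Lemma cone0 A : cone A 0.
Proof. by exists 0, 0; rewrite scaler0 ltxx. Qed.

Lemma coneZ A (a : R) x : 0 <= a -> cone A x -> cone A (a *: x).
Proof.
move=> a0 [c [d [c0 Ad ->]]]; exists (a * c), d; rewrite mulr_ge0 ?scalerA//.
split=> // ac0; apply: Ad; rewrite lt_neqAle c0 andbT.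
by apply: contraTneq ac0 => <-; rewrite mulr0 ltxx.
Qed.

Lemma coneD A x y : convex A -> cone A x -> cone A y -> cone A (x + y).
Proof.
move=> cA [a [d [a0 Ad ->]]] [b [e [b0 Ae ->]]].
move: a0 b0; rewrite !le_eqVlt => /predU1P[<-|a0] /predU1P[<-|b0].
- rewrite !scale0r addr0; exact: cone0.
- by rewrite scale0r add0r; exists b, e; rewrite ltW.
- by rewrite scale0r addr0; exists a, d; rewrite ltW.
have [f Af ->] := convexD cA (ltW a0) (ltW b0) (Ad a0) (Ae b0).
by exists (a + b), f; rewrite addr_ge0 ?ltW.
Qed.

Lemma cone_sum A (I : finType) (p : pred I) (f : I -> vec R Omega) :
  convex A -> (forall i, p i -> cone A (f i)) -> cone A (\sum_(i | p i) f i).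
Proof.
by move=> cA Af; apply: big_ind => //; [exact: cone0|move=> x y; exact: coneD].
Qed.

Lemma convex_cone A : convex A -> convex (cone A).
Proof.
move=> cA; apply/convexP => x y a b a0 b0 _ Ax Ay.
by apply: coneD => //; exact: coneZ.
Qed.

Lemma convex_simplex : convex (@simplex R Omega).
Proof.
apply/convexP => x y a b a0 b0 ab [x0 x1] [y0 y1]; split.
  by move=> w; rewrite addr_ge0// mulr_ge0.
by rewrite big_split/= -!mulr_sumr x1 y1 !mulr1.
Qed.

(** Comparing coordinate sums forces the scaling factor to be 1. *)
Lemma cone_simplex A x : A `<=` simplex -> simplex x -> cone A x -> A x.
Proof.
move=> sA [_ x1] [c [d [c0 Ad xE]]].
move: c0; rewrite le_eqVlt => /predU1P[c0|c0].
  move: x1; rewrite xE -c0 scale0r big1// => /eqP.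
  by rewrite eq_sym oner_eq0.
have {}Ad := Ad c0; have [_ d1] := sA d Ad.
by move: x1; rewrite xE -mulr_sumr d1 mulr1 => ->; rewrite scale1r.
Qed.

Lemma Conv_cone S : Conv (S `|` [set 0]) `<=` cone (Conv S).
Proof.
apply: smallest_sub; first exact/convex_cone/convex_Conv.
move=> x [Sx|->]; last exact: cone0.
by apply: cone_sub; exact: sub_gen_smallest.
Qed.

(** The scaling factor is the total mass of [x]; being at most 1, it leaves the weight [1 - c] for
    the point 0. Membership in a hull with 0 thus reduces to a cone condition and a mass bound. *)
Lemma cone_Conv S x : S `<=` simplex -> cone (Conv S) x -> \sum_w x w <= 1 ->
  Conv (S `|` [set 0]) x.
Proof.
move=> sS [c [d [c0 Sd ->]]]; move: c0; rewrite le_eqVlt => /predU1P[<- _|c0].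
  by rewrite scale0r; apply: sub_gen_smallest; right.
have {}Sd := Sd c0.
have [_ d1] : simplex d by apply: smallest_sub Sd => //; exact: convex_simplex.
rewrite -mulr_sumr d1 mulr1 => c1.
have /convexP/(_ d 0 c (1 - c)) := @convex_Conv (S `|` [set 0]).
rewrite scaler0 addr0; apply; rewrite ?(ltW c0) ?subr_ge0 ?subrKC//.
  by apply: (Conv_le _ Sd) => z Sz; apply: sub_gen_smallest; left.
by apply: sub_gen_smallest; right.
Qed.

Lemma vec_vertexE x : x = \sum_w x w *: vertex w.
Proof.
apply/funext => w; rewrite fct_sumE (bigD1 w)//= big1 ?addr0.
  by rewrite fctE /vertex eqxx [RHS]mulr1.
by move=> i iw; rewrite fctE /vertex eq_sym (negPf iw) [LHS]mulr0.
Qed.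

Lemma vertex_simplex w : simplex (vertex w : vec R Omega).
Proof.
split=> [w'|]; first by rewrite /vertex ler0n.
by rewrite (bigD1 w)//= big1 /vertex ?eqxx ?addr0// => i /negPf ->.
Qed.

Lemma Conv_ge0 (S : set (vec R Omega)) x w :
  S `<=` simplex -> Conv (S `|` [set 0]) x -> 0 <= x w.
Proof.
move=> sS /Conv_cone[c [d [+ Sd ->]]]; rewrite le_eqVlt => /predU1P[<-|c0].
  by rewrite scale0r.
have [d0 _] : simplex d.
  by apply: smallest_sub (Sd c0) => //; exact: convex_simplex.
by apply: mulr_ge0; [exact: ltW|exact: d0].
Qed.

End Convexity.

(** * Threshold points and the hull containing [P rho true] *)

Section Persuasion.
Context {R : realType} {Omega : finType} (rho : vec R Omega -> bool -> R).
Implicit Types (x y z : vec R Omega).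

Local Notation P1 := (P rho true).
Local Notation G1 := (K rho true `|` K01 rho).

Lemma K_or_L0 w : K rho true (vertex w) \/ L0 rho (vertex w).
Proof.
have [Pw|nPw] := pselect (P1 (vertex w)); first by left; split=> //; exists w.
right; split; last by case.
split; last by exists w.
split; first exact: vertex_simplex.
apply/ltW; rewrite ltNge; apply/negP => Pw; apply: nPw; split => //.
exact: vertex_simplex.
Qed.

Lemma L0_nP1 x : L0 rho x -> (simplex `\` P1) x.
Proof. by case=> -[[sx _] vx] nK; split=> // Px; exact: nK. Qed.

Lemma gamma_set0 x0 x1 : P1 x1 ->
  [set g : R | 0 <= g <= 1 /\ P1 (g *: x0 + (1 - g) *: x1)] 0.
Proof. by move=> Px1; rewrite /= lexx ler01 scale0r add0r subr0 scale1r. Qed.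

Lemma gamma_set_ub x0 x1 :
  has_ubound [set g : R | 0 <= g <= 1 /\ P1 (g *: x0 + (1 - g) *: x1)].
Proof. by exists 1 => g [/andP[]]. Qed.

Lemma nP1_gt_gamma x0 x1 (g : R) : 0 <= g <= 1 -> gamma rho x0 x1 < g ->
  ~ P1 (g *: x0 + (1 - g) *: x1).
Proof.
move=> g01 ltg Pg; move: ltg; rewrite ltNge => /negP; apply.
by apply: sup_ubound; [exact: gamma_set_ub|].
Qed.

(** The admissible weights form a closed set, the preimage of [P rho true] under a continuous path
    cut to [0, 1], so the supremum is attained. *)
Lemma gammaP x0 x1 : closed (P1 : set {ptws Omega -> R^o}) -> P1 x1 ->
  0 <= gamma rho x0 x1 <= 1 /\ P1 (chi rho x0 x1).
Proof.
move=> P1_closed Px1.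
set E := [set g : R | 0 <= g <= 1 /\ P1 (g *: x0 + (1 - g) *: x1)].
suff E_closed : closed E.
  have := closure_sup (ex_intro E 0 (gamma_set0 x0 Px1)) (gamma_set_ub x0 x1).
  by move/E_closed.
pose f (g : R) : {ptws Omega -> R^o} := g *: x0 + (1 - g) *: x1.
have cf : continuous f.
  apply: continuous_ptws => w.
  have cc (c : R) : continuous (fun g : R => c) by exact: cst_continuous.
  have ci : continuous (fun g : R => g) by move=> g; exact: cvg_id.
  exact: (continuous_addR (continuous_mulR ci (cc (x0 w)))
           (continuous_mulR (continuous_subR (cc 1) ci) (cc (x1 w)))).
have -> : E = `[0, 1]%classic `&` f @^-1` P1.
  by apply/seteqP; split => g /=; rewrite in_itv.
apply: closedI; first exact: itv_closed.
by move/continuous_closedP: cf; apply.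
Qed.

Hypothesis P1_closed : closed (P1 : set {ptws Omega -> R^o}).

Lemma G1_P1 : G1 `<=` P1.
Proof.
move=> x [[]//|[x0 _ [x1 [Px1 _] <-]]].
by have [] := gammaP x0 P1_closed Px1.
Qed.

Lemma G1_simplex : G1 `<=` simplex.
Proof. by move=> x /G1_P1[]. Qed.

Lemma L0_simplex : L0 rho `<=` simplex.
Proof. by move=> x /L0_nP1[]. Qed.

Lemma finite_K a : finite_set (K rho a).
Proof. by apply: finite_setIr; apply: finite_image. Qed.

Lemma finite_L0 : finite_set (L0 rho).
Proof. by apply: finite_setD; exact: finite_K. Qed.

Lemma finite_G1 : finite_set G1.
Proof.
rewrite finite_setU; split; first exact: finite_K.
by apply: finite_image2; [exact: finite_L0|exact: finite_K].
Qed.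

Lemma sum_vertex (F : Omega -> R) w : \sum_w' F w' * vertex w w' = F w.
Proof.
rewrite (bigD1 w)//= big1 ?addr0 /vertex ?eqxx ?mulr1//.
by move=> i /negPf ->; rewrite mulr0.
Qed.

Hypothesis nP1_convex : convex (simplex `\` P1).

(** The vector is the zero of [F] on the edge, scaled by [F j - F i]. This form without division is
    the one summed in [P1_sub]. *)
Lemma cone_nP1_edge (F : Omega -> R) i j :
  (forall y, G1 y -> 0 < \sum_w F w * y w) -> F i < 0 -> 0 <= F j ->
  cone (simplex `\` P1) (F j *: vertex i - F i *: vertex j).
Proof.
move=> FG Fi Fj.
have L0i : L0 rho (vertex i).
  have [Ki|//] := K_or_L0 i.
  by have := FG _ (or_introl Ki); rewrite sum_vertex ltNge ltW.
(* If [j] is in [L0 rho], both ends of the edge lie in the complement and have nonnegative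
   coefficients. *)
have [Kj|L0j] := K_or_L0 j; last first.
  rewrite -scaleNr; apply: coneD => //.
    by apply: coneZ => //; apply: cone_sub; exact: L0_nP1.
  by apply: coneZ; [rewrite oppr_ge0 ltW|apply: cone_sub; exact: L0_nP1].
have [/andP[g0 g1] Pchi] := gammaP (vertex i) P1_closed (proj1 Kj).
have d_gt0 : 0 < F j - F i by lra.
(* The weight of [vertex i] at which [F] vanishes on the edge. *)
pose g := F j / (F j - F i).
have g01 : 0 <= g <= 1.
  by rewrite divr_ge0 ?(ltW d_gt0)//= ler_pdivrMr// mul1r; lra.
exists (F j - F i), (g *: vertex i + (1 - g) *: vertex j); split.
- exact: ltW.
- move=> _; split.
    have /andP[gg0 gg1] := g01.
    by move/convexP: (@convex_simplex R Omega); apply;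
      rewrite ?subr_ge0 ?subrKC//; exact: vertex_simplex.
  apply: nP1_gt_gamma => //; set c := gamma _ _ _ in g0 g1 *.
  have := FG _ (or_intror (ex_intro2 _ _ _ L0i (ex_intro2 _ _ _ Kj erefl))).
  have -> : \sum_w F w * chi rho (vertex i) (vertex j) w =
      c * F i + (1 - c) * F j.
    rewrite -(sum_vertex F i) -(sum_vertex F j) !mulr_sumr -big_split/=.
    apply: eq_bigr => w _; rewrite /chi -/c.
    have E (f v1 v2 : R) : f * (c * v1 + (1 - c) * v2) =
      c * (f * v1) + (1 - c) * (f * v2) by ring.
    exact: E.
  (* [F] decreases with the weight of [vertex i], so its positivity at [chi] means [c < g]. *)
  move=> cF; rewrite ltr_pdivlMr//; lra.
- have gd : (F j - F i) * g = F j by rewrite mulrCA divff ?mulr1 ?gt_eqF.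
  rewrite scalerDr !scalerA gd mulrBr gd mulr1 -scaleNr.
  by congr (_ + _ *: _); lra.
Qed.

Lemma P1_sub : P1 `<=` Conv (G1 `|` [set 0]).
Proof.
move=> x P1x; apply: contrapT => nQx.
have sx : simplex x by case: P1x.
have Q_compact : compact (Conv (G1 `|` [set 0]) : set {ptws Omega -> R^o}).
  apply: compact_Conv; rewrite finite_setU.
  by split; [exact: finite_G1|exact: finite_set1].
have Q0 : Conv (G1 `|` [set 0]) !=set0.
  by exists 0; apply: sub_gen_smallest; right.
have [a [b [ax ay]]] := separation (@convex_Conv _ _ _) Q_compact Q0 nQx.
(* Coordinates in the simplex sum to 1, so the level [b] can be absorbed into the coefficients,
   giving a linear form. *)
pose F w := a w - b.
have FE y : simplex y -> \sum_w F w * y w = \sum_w a w * y w - b.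
  case=> _ y1; under eq_bigr do rewrite mulrBl.
  by rewrite sumrB -mulr_sumr y1 mulr1.
have FG y : G1 y -> 0 < \sum_w F w * y w.
  move=> Gy; rewrite FE ?subr_gt0; last exact: G1_simplex.
  by apply: ay; apply: sub_gen_smallest; left.
have Fx : \sum_w F w * x w < 0 by rewrite FE// subr_lt0.
suff /(cone_simplex (@subDsetl _ _ _) sx) [] : cone (simplex `\` P1) x by [].
(* The value of [F] at [x] is [p - n], hence [p < n]. *)
pose n := \sum_(i | F i < 0) x i * - F i.
pose p := \sum_(j | ~~ (F j < 0)) x j * F j.
have p_ge0 : 0 <= p.
  apply: sumr_ge0 => j; rewrite -leNgt => Fj.
  by apply: mulr_ge0 => //; case: sx.
have pn : p < n.
  rewrite -subr_lt0; move: Fx; rewrite (bigID (fun i => F i < 0))/=.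
  rewrite addrC; congr (_ + _ < _).
    by apply: eq_bigr => j _; rewrite mulrC.
  by rewrite /n -sumrN; apply: eq_bigr => j _; rewrite mulrN opprK mulrC.
have n_gt0 : 0 < n by lra.
(* A product coupling: each [j] with [F j >= 0] is spread over the negative states [i] in proportion
   to [x i * - F i]. This uses up all of [x j] and the share [p / n] of each [x i]; the rest of
   [x i] stays at its vertex. *)
have -> : x = \sum_(i | F i < 0) (x i * (1 - p / n)) *: vertex i +
    \sum_(i | F i < 0) \sum_(j | ~~ (F j < 0))
      (x i * x j / n) *: (F j *: vertex i - F i *: vertex j).
  rewrite [LHS]vec_vertexE (bigID (fun i => F i < 0))/=.
  have pairE i : \sum_(j | ~~ (F j < 0))
      (x i * x j / n) *: (F j *: vertex i - F i *: vertex j) =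
      (x i * (p / n)) *: vertex i -
      \sum_(j | ~~ (F j < 0)) (x i * x j / n * F i) *: vertex j.
    under eq_bigr do rewrite scalerBr !scalerA.
    rewrite sumrB -scaler_suml; congr (_ *: _ - _).
    rewrite /p mulr_suml mulr_sumr; apply: eq_bigr => j _.
    by rewrite -!mulrA; congr (_ * (_ * _)); rewrite mulrC.
  under [X in _ = _ + X]eq_bigr do rewrite pairE.
  rewrite sumrB addrA -big_split/=; congr (_ + _).
    apply: eq_bigr => i _; rewrite -scalerDl -mulrDr subrK.
    by rewrite mulr1.
  rewrite exchange_big/= -sumrN; apply: eq_bigr => j _.
  rewrite -scaler_suml -scaleNr -sumrN; congr (_ *: _).
  transitivity (n * (x j / n)); first by rewrite mulrCA divff ?mulr1// gt_eqF.
  rewrite mulr_suml; apply: eq_bigr => i _.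
  by rewrite !mulrN mulNr mulrAC -!mulrA.
apply: coneD => //.
  apply: cone_sum => // i Fi; apply: coneZ.
    apply: mulr_ge0; first by case: sx.
    by rewrite subr_ge0 ler_pdivrMr// mul1r ltW.
  apply: cone_sub; apply: L0_nP1.
  have [Ki|//] := K_or_L0 i.
  by have := FG _ (or_introl Ki); rewrite sum_vertex ltNge ltW.
apply: cone_sum => // i Fi; apply: cone_sum => // j Fj; apply: coneZ.
  by case: sx => x0 _; rewrite divr_ge0 ?mulr_ge0 ?(ltW n_gt0).
by apply: cone_nP1_edge => //; rewrite leNgt.
Qed.
End Persuasion.

(** * Comparison of the two programs and existence of a maximum *)

Section Programs.
Context {R : realType} {Omega : finType} (rho : vec R Omega -> bool -> R).
Context (mu : vec R Omega) (v : Omega -> bool -> R).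
Implicit Types (x y z : vec R Omega) (t : bool -> vec R Omega).

Local Notation P1 := (P rho true).
Local Notation G1 := (K rho true `|` K01 rho).

Hypothesis P1_closed : closed (P1 : set {ptws Omega -> R^o}).

Lemma feasibleL_C : feasibleL rho mu `<=` feasibleC rho mu.
Proof.
move=> t [t0 t1 tmu]; split=> //.
  apply: (Conv_le _ t0) => x [[[Px _] _]|x0]; apply: sub_gen_smallest.
    by left.
  by right.
apply: (Conv_le _ t1) => x [Gx|x0]; apply: sub_gen_smallest; [left|by right].
exact: G1_P1.
Qed.

Hypothesis mu_simplex : simplex mu.
Hypothesis v_le : forall w, v w false <= v w true.

(** The hypotheses are weaker than feasibility for (C) combined with [P1_sub], so that the pair with
    all of [mu] in [t false] also qualifies; it shows that (L) is feasible. *)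
Lemma feasibleL_dominates t :
  (forall w, 0 <= t false w) -> (forall w, 0 <= t true w) ->
  cone (Conv G1) (t true) -> (forall w, t false w + t true w = mu w) ->
  exists2 t', feasibleL rho mu t' & objective v t <= objective v t'.
Proof.
move=> t0_ge0 t1_ge0 Gt1 tmu.
(* The mass to move: the part of [t false] on states of [K rho true]. What remains sits on [L0 rho]
   by [K_or_L0]. *)
pose m : vec R Omega :=
  fun w => if `[<K rho true (vertex w)>] then t false w else 0.
have m_ge0 w : 0 <= m w by rewrite /m; case: ifP.
have m_le w : m w <= t false w by rewrite /m; case: ifP.
exists (fun a => if a then t true + m else t false - m); last first.
  rewrite /objective; apply: ler_sum => w _ /=.
  have E (a b c d e : R) : 0 <= c -> b <= a ->
    a * d + b * e <= a * (d + c) + b * (e - c) by nra.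
  exact: E.
(* Supplies the mass bound of [cone_Conv]: a summand of [mu] whose complement is nonnegative has
   mass at most 1. *)
have mass1 (x y : vec R Omega) : (forall w, 0 <= y w) ->
    (forall w, x w + y w = mu w) -> \sum_w x w <= 1.
  move=> y0 xy; have [_ <-] := mu_simplex; apply: ler_sum => w _.
  by rewrite -xy lerDl.
split.
- apply: cone_Conv => /=; first exact: L0_simplex.
    rewrite [_ - _]vec_vertexE; apply: cone_sum => [|w _].
      exact: convex_Conv.
    have -> : (t false - m) w = t false w - m w by [].
    rewrite /m; case: asboolP => Kw.
      by rewrite subrr scale0r; exact: cone0.
    rewrite subr0; apply: coneZ => //; apply: cone_sub; apply: sub_gen_smallest.
    by have [] := K_or_L0 rho w.
  apply: (mass1 _ (t true + m)) => w; first exact: addr_ge0.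
  rewrite -tmu; have E (a b c : R) : a - c + (b + c) = a + b by ring.
  exact: E.
- apply: cone_Conv => /=; first exact: G1_simplex.
    apply: coneD => //; first exact: convex_Conv.
    rewrite [m]vec_vertexE; apply: cone_sum => [|w _]; first exact: convex_Conv.
    rewrite /m; case: asboolP => Kw; last by rewrite scale0r; exact: cone0.
    by apply: coneZ => //; apply: cone_sub; apply: sub_gen_smallest; left.
  apply: (mass1 _ (t false - m)) => w.
    by have := m_le w; rewrite -subr_ge0.
  rewrite -tmu; have E (a b c : R) : b + c + (a - c) = a + b by ring.
  exact: E.
- move=> w; rewrite -tmu /=.
  have E (a b c : R) : a - c + (b + c) = a + b by ring.
  exact: E.
Qed.

(** The constraint determines [t true] as [mu - t false], so a continuous function of [t false]
    alone is maximised over the intersection of a compact hull with a closed preimage. *)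
Lemma feasibleL_max : exists2 t, feasibleL rho mu t &
  forall t', feasibleL rho mu t' -> objective v t' <= objective v t.
Proof.
have c0 : compact (Conv (L0 rho `|` [set 0]) : set {ptws Omega -> R^o}).
  apply: compact_Conv; rewrite finite_setU.
  by split; [exact: finite_L0|exact: finite_set1].
have c1 : compact (Conv (G1 `|` [set 0]) : set {ptws Omega -> R^o}).
  apply: compact_Conv; rewrite finite_setU.
  by split; [exact: finite_G1|exact: finite_set1].
pose f (x : {ptws Omega -> R^o}) : {ptws Omega -> R^o} :=
  (mu : vec R Omega) - (x : vec R Omega).
have cc (c : R) : continuous (fun x : {ptws Omega -> R^o} => c).
  exact: cst_continuous.
have ce (w : Omega) : continuous (fun x : {ptws Omega -> R^o} => x w : R).
  exact: ptws_eval_continuous.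
have cf : continuous f.
  by apply: continuous_ptws => w; exact: (continuous_subR (cc (mu w)) (ce w)).
have cl1 : closed (f @^-1` (Conv (G1 `|` [set 0]))).
  move/continuous_closedP: cf; apply; apply: compact_closed => //.
  by apply: hausdorff_product => w; exact: Rhausdorff.
have cS := compact_closedI c0 cl1.
pose obj (x : {ptws Omega -> R^o}) : R :=
  \sum_w (v w true * (mu w - x w) + v w false * x w).
have cobj : continuous obj.
  apply: (@continuous_big_sum _ R Omega
    (fun w (x : {ptws Omega -> R^o}) =>
       v w true * (mu w - x w) + v w false * x w)) => w.
  exact: (continuous_addR
    (continuous_mulR (cc (v w true)) (continuous_subR (cc (mu w)) (ce w)))
    (continuous_mulR (cc (v w false)) (ce w))).
have tE t : feasibleL rho mu t -> t true = f (t false).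
  case=> _ _ tmu; apply/funext => w.
  have E (a b c : R) : a + b = c -> b = c - a by move=> <-; rewrite addrC addKr.
  exact: E (tmu w).
have objE t : feasibleL rho mu t -> objective v t = obj (t false).
  by move=> /tE tt; apply: eq_bigr => w _; rewrite tt.
have S0 : Conv (L0 rho `|` [set 0]) `&` f @^-1` Conv (G1 `|` [set 0]) !=set0.
  have [||||t tL _] := @feasibleL_dominates (fun a => if a then 0 else mu).
  - by case: mu_simplex.
  (* The pair ([mu], 0) meets the sign conditions; its second component lies in every cone. *)
  - by [].
  - exact: cone0.
  - by move=> w; exact: addr0.
  exists (t false); split; first by case: tL.
  by rewrite /= -tE//; case: tL.
have [x /set_mem [x0 x1] xmax] :=
  @compact_EVT_max {ptws Omega -> R^o} R obj _ S0 cS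
    (continuous_subspaceT cobj).
have xL : feasibleL rho mu (fun a => if a then f x else x).
  by split=> // w /=; exact: subrKC.
exists (fun a => if a then f x else x) => // t tL; rewrite !objE//.
by apply: xmax; rewrite inE; split; [case: tL|rewrite /= -tE//; case: tL].
Qed.

End Programs.

Theorem theorem3 (R : realType) (Omega : finType) (hOmega : (0 < #|Omega|)%N)
    (mu : vec R Omega) (hmu : simplex mu)
    (rho : vec R Omega -> bool -> R) (v : Omega -> bool -> R)
    (hv : forall w : Omega, v w false <= v w true)
    (hP0 : closed (P rho false : set {ptws Omega -> R^o}))
    (hP1 : closed (P rho true : set {ptws Omega -> R^o}))
    (hconv : convex (simplex `\` P rho true)) :
  (exists m : R, optimal_value v (feasibleC rho mu) m /\
                 optimal_value v (feasibleL rho mu) m) /\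
  (forall t : bool -> vec R Omega,
     optimal_solution v (feasibleL rho mu) t ->
     optimal_solution v (feasibleC rho mu) t).
Proof.
have dom t : feasibleC rho mu t ->
    exists2 t', feasibleL rho mu t' & objective v t <= objective v t'.
  case=> t0 t1 tmu; apply: feasibleL_dominates => //.
  - by move=> w; apply: Conv_ge0 t0 => x [].
  - by move=> w; apply: Conv_ge0 t1 => x [].
  (* Here [P1_sub] replaces the generators of (C) for action 1 by those of (L). *)
  apply: Conv_cone; apply: (Conv_le _ t1) => x [P1x|x0]; first exact: P1_sub.
  by apply: sub_gen_smallest; right.
have opt t : optimal_solution v (feasibleL rho mu) t ->
    optimal_solution v (feasibleC rho mu) t.
  move=> [tL tmax]; split; first exact: feasibleL_C.
  by move=> t' /dom[t'' /tmax + /le_trans]; move=> h; exact.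
split=> //.
have [t tL tmax] := feasibleL_max hP1 hmu hv.
have [tC tmaxC] := opt t (conj tL tmax).
(* One maximiser of (L) attains both optimal values. *)
exists (objective v t); split; split; try (by exists t).
  by move=> _ [t' /tmaxC h <-].
by move=> _ [t' /tmax h <-].
Qed.
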